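(* Let $k$ be a commutative ring, $n\ge1$, and let $E$ be an $(n-1)$-commutative cosimplicial monoid in $k$-modules. For $a\in E(p)$, $b\in E(q)$ and $0\le i\le n-1$, the Steenrod product $a\cup_i b\in E(p+q-i)$ on the normalised totalisation of $E$ is given by $$a\cup_i b=\sum_{\psi\in \mathrm{slp}^{(i+1)}_{+m}(p,q)}(-1)^{(p-1)(q-1)}\,\mathrm{sgn}(\psi)\,\psi(a\otimes b),\qquad m=p+q-i .$$ For $n\ge2$ the degree $1-n$ bracket $\beta^{(n-1)}:E(p)\otimes E(q)\to E(p+q-n+1)$ is given by $$\beta^{(n-1)}(a\otimes b)=a\cup_{n-1}b-(-1)^{n+(p-1)(q-1)}\,b\cup_{n-1}a$$ $$=\sum_{\psi\in \mathrm{slp}^{(n)}_{+m}(p,q)}(-1)^{(p-1)(q-1)}\,\mathrm{sgn}(\psi)\,\psi(a\otimes b)+\sum_{\psi\in \mathrm{slp}^{(n)}_{-m}(p,q)}(-1)^{n-1}\,\mathrm{sgn}(\psi)\,\psi(a\otimes b),\qquad m=p+q-n+1 .$$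
   Context: **Cosimplicial monoids.** $\Delta$ is the category of $[m]=\{0<\dots<m\}$, $m\ge 0$, and nondecreasing maps; a cosimplicial monoid in $k$-modules is a functor $E$ from $\Delta$ to (associative unital) $k$-algebras. For nondecreasing $\tau:[p]\to[m]$, $\pi:[q]\to[m]$, a shuffling of length $n$ is a pair of decompositions into nonempty disjoint sets $Im(\tau)=A_1\cup\dots\cup A_s$, $A_1<\dots<A_s$, $Im(\pi)=B_1\cup\dots\cup B_t$, $B_1<\dots<B_t$, $s+t=n+1$, $|s-t|\le1$, with $A_1\le B_1\le A_2\le B_2\le\cdots$ or $B_1\le A_1\le B_2\le A_2\le\cdots$ (where $A\le B$ means each element of $A$ is $\le$ each element of $B$). The linking number $\mathbf{lk}(\tau,\pi)$ is the least length of a shuffling. $E$ is $n$-commutative ($n\ge1$) if the images of $E(\tau)$ and $E(\pi)$ commute elementwise in $E(m)$ whenever $\mathbf{lk}(\tau,\pi)\le n$; every cosimplicial monoid is $0$-commutative. The normalised totalisation consists of the normalised cochains, i.e. the elements killed by all codegeneracies. **Lattice paths.** A lattice path $\psi:\langle m+1\rangle\to\langle p+1\rangle\square\langle q+1\rangle$ (a functor from the poset $\{0<\dots<m+1\}$ to the funny tensor product of the posets $\{0<\dots<p+1\}$ and $\{0<\dots<q+1\}$ preserving end points) amounts to a path of unit steps in the positive directions $1$ and $2$ from $(0,0)$ to $(p+1,q+1)$, together with nonnegative integer labels on the lattice points, which are $0$ off the path, positive at the two end points, and have sum $m+2$; listing the points of the path with multiplicity given by labels gives the sequence $\psi(0),\dots,\psi(m+1)$.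 The path is encoded by a word in letters $1,2$ containing $p+1$ letters $1$ and $q+1$ letters $2$. Its complexity is the number of corners (changes of letter). It is even if its first step is in direction $1$ and odd if the first step is in direction $2$. Its sign $\mathrm{sgn}(\psi)$ is $(-1)^{r}$, where $r$ is the number of pairs (a letter $2$, a letter $1$) with the $2$ occurring before the $1$ in the word (this is the sign of the associated shuffle permutation). $\psi$ is normal if all corners have label $0$ and all other points of the path have label $1$; $\mathrm{nlp}^{(n)}_m(p,q)$ is the set of normal lattice paths of complexity exactly $n$ (necessarily $m=p+q-n+1$), and $\mathrm{nlp}^{(n)}_{\pm m}(p,q)$ are its subsets of even ($+$) and odd ($-$) paths. $\psi$ is smooth if the sequence $\psi(0),\dots,\psi(m+1)$ in the commutative lattice is a smooth Delannoy path: every step is $(1,0)$, $(0,1)$ or $(1,1)$, and no step $(1,0)$ is immediately followed by $(0,1)$ nor a step $(0,1)$ immediately by $(1,0)$. $\mathrm{slp}^{(n)}_m(p,q)$ is the set of smooth lattice paths $\langle m+1\rangle\to\langle p+1\rangle\square\langle q+1\rangle$ of complexity exactly $n$, where $m=p+q-n+1$, and $\mathrm{slp}^{(n)}_{\pm m}(p,q)$ are its subsets of even ($+$) and odd ($-$) paths. **Action.** Write $\psi(i)=(x(i),y(i))$. Let $f_1:[p]\to[m]$ and $f_2:[q]\to[m]$ be the Joyal duals: $f_1(j)$ is the unique $i$ with $x(i)\le j<x(i+1)$, and $f_2(j)$ the unique $i$ with $y(i)\le j<y(i+1)$. Then $\psi(a\otimes b)=E(f_1)(a)\cdot E(f_2)(b)$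 if $\psi$ is even and $\psi(a\otimes b)=E(f_2)(b)\cdot E(f_1)(a)$ if $\psi$ is odd. **Operations.** The lattice paths of complexity at most $n$ act on $E$ in this way, and the general definition of the Steenrod products, for $0\le i\le n-1$, is $x\cup_i y=\sum_{\psi\in\mathrm{nlp}^{(i+1)}_{+m}(p,q)}(-1)^{(p-1)(q-1)}\mathrm{sgn}(\psi)\psi(x\otimes y)$ (sum over normal, not only smooth, even paths). The chain-level bracket is $\beta^{(n-1)}(x\otimes y)=x\cup_{n-1}y-(-1)^n(-1)^{(p-1)(q-1)}y\cup_{n-1}x$.
   Formalization: In the last sum (odd paths) the coefficient is (-1)^{(p-1)(q-1)}(-1)^{n-1}sgn(ψ) instead of the printed (-1)^{n-1}sgn(ψ), which is false for p, q both even (e.g. n=3, p=q=2, E commutative: the bracket is 0 but the printed sum is -2ab). *)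

(* Defs.v *)
From HB Require Import structures.
From mathcomp Require Import all_boot all_order all_algebra.
Set Implicit Arguments.
Unset Strict Implicit.
Unset Printing Implicit Defensive.
Import GRing.Theory.
Local Open Scope ring_scope.

(* [delta p m] is the set of nondecreasing maps [p] -> [m], where [m] is the
   ordinal {0 < ... < m}, i.e. ['I_m.+1]. *)
Section Delta.

Variables p m : nat.

Definition nondec (f : {ffun 'I_p.+1 -> 'I_m.+1}) : bool :=
  [forall i : 'I_p.+1, forall j : 'I_p.+1, (i <= j)%N ==> (f i <= f j)%N].

Record delta := Delta { delta_fun :> {ffun 'I_p.+1 -> 'I_m.+1};
                        _ : nondec delta_fun }.

HB.instance Definition _ := [isSub for delta_fun].
HB.instance Definition _ := [Finite of delta by <:].

Lemma deltaP (f : delta) (i j : 'I_p.+1) : (i <= j)%N -> (f i <= f j)%N.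
Proof. by case: f => f /= /forallP/(_ i)/forallP/(_ j)/implyP. Qed.

Lemma nondecP (f : 'I_p.+1 -> 'I_m.+1) :
  (forall i j : 'I_p.+1, (i <= j)%N -> (f i <= f j)%N) -> nondec (finfun f).
Proof.
move=> fP; apply/forallP=> i; apply/forallP=> j; apply/implyP.
by rewrite !ffunE; apply: fP.
Qed.

Definition mk_delta (f : 'I_p.+1 -> 'I_m.+1)
    (fP : forall i j : 'I_p.+1, (i <= j)%N -> (f i <= f j)%N) : delta :=
  Delta (nondecP fP).

Definition im (f : delta) : {set 'I_m.+1} := [set f i | i : 'I_p.+1].

End Delta.

Definition delta_id (m : nat) : delta m m := mk_delta (fun i j => id).

Lemma delta_comp_subproof p q r (g : delta q r) (f : delta p q)
  (i j : 'I_p.+1) : (i <= j)%N -> (g (f i) <= g (f j))%N.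
Proof. by move=> le_ij; do 2!apply: deltaP. Qed.

Definition delta_comp p q r (g : delta q r) (f : delta p q) : delta p r :=
  mk_delta (delta_comp_subproof g f).

Lemma codegen_subproof m (j : 'I_m.+1) (i : 'I_m.+2) :
  ((if (i <= j)%N then i : nat else i.-1) < m.+1)%N.
Proof.
case: (leqP i j) => [ij|ji]; first exact: leq_ltn_trans ij (ltn_ord j).
by rewrite -ltnS (ltn_predK ji).
Qed.

Lemma codegen_mono m (j : 'I_m.+1) (i1 i2 : 'I_m.+2) : (i1 <= i2)%N ->
  (Ordinal (codegen_subproof j i1) <= Ordinal (codegen_subproof j i2))%N.
Proof.
move=> le12 /=; case: (leqP i1 j) => j1; case: (leqP i2 j) => j2 //.
- by rewrite -ltnS (ltn_predK j2); apply: leq_ltn_trans j1 j2.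
- by have := leq_trans j1 (leq_trans le12 j2); rewrite ltnn.
- by rewrite -ltnS (ltn_predK j1) (ltn_predK j2).
Qed.

(* The codegeneracy [m+1] -> [m] hitting j twice. *)
Definition codegen m (j : 'I_m.+1) : delta m.+1 m := mk_delta (codegen_mono j).

(* [algType] asks for 1 != 0.  There are maps [m] -> [p] for all m and p, so the
   only functor this excludes is the one that is zero in every degree. *)
Record cosimplicial_monoid (k : comPzRingType) := CosimplicialMonoid {
  cosimp_ob :> nat -> algType k;
  cosimp_map : forall p m : nat,
    delta p m -> {lrmorphism cosimp_ob p -> cosimp_ob m};
  cosimp_map_id : forall m : nat, cosimp_map (delta_id m) =1 id;
  cosimp_map_comp : forall (p q r : nat) (g : delta q r) (f : delta p q),
    cosimp_map (delta_comp g f) =1 cosimp_map g \o cosimp_map f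
}.

Definition normalised (k : comPzRingType) (E : cosimplicial_monoid k) (p : nat)
    : E p -> Prop :=
  match p with
  | 0 => fun=> True
  | p'.+1 => fun a => forall j : 'I_p'.+1, cosimp_map E (codegen j) a = 0
  end.

Section LinkingNumber.

Variable N : nat.
Implicit Types (X Y : {set 'I_N}) (A B : seq {set 'I_N}).

Definition set_lt X Y : bool := [forall x in X, forall y in Y, (x < y)%N].
Definition set_le X Y : bool := [forall x in X, forall y in Y, (x <= y)%N].

Definition decomposition X A : bool :=
  [&& \bigcup_(Z <- A) Z == X, set0 \notin A & pairwise set_lt A].

(* A_1, B_1, A_2, B_2, ... *)
Fixpoint interleave A B : seq {set 'I_N} :=
  match A, B with
  | a :: A', b :: B' => [:: a, b & interleave A' B']
  | [::], _ => B
  | _, [::] => A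
  end.

(* A_1 <= B_1 <= A_2 <= B_2 <= ..., ending with either an A or a B; in
   particular |s - t| <= 1. *)
Definition alternating A B : bool :=
  (size B <= size A <= (size B).+1)%N && sorted set_le (interleave A B).

Definition is_shuffling X Y A B : bool :=
  [&& decomposition X A, decomposition Y B & alternating A B || alternating B A].

Definition has_shuffling X Y (n : nat) : bool :=
  [exists s : 'I_n.+2, exists A : s.-tuple {set 'I_N},
    exists B : (n.+1 - s).-tuple {set 'I_N}, is_shuffling X Y A B].

Lemma has_shufflingP X Y n :
  reflect (exists A B, (size A + size B)%N = n.+1 /\ is_shuffling X Y A B)
          (has_shuffling X Y n).
Proof.
apply: (iffP existsP) => [[s /existsP[A /existsP[B AB]]]|[A [B [sAB AB]]]].
  by exists A, B; rewrite !size_tuple subnKC // -ltnS.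
have sA : (size A < n.+2)%N by rewrite ltnS -sAB leq_addr.
have sB : size B == (n.+1 - Ordinal sA)%N by rewrite eq_sym -(addKn (size A) (size B)) sAB.
exists (Ordinal sA); apply/existsP; exists (in_tuple A).
by apply/existsP; exists (Tuple sB).
Qed.

Lemma interleave_cons Z A B : interleave (Z :: A) B = Z :: interleave B A.
Proof.
by elim: A Z B => [|a A IH] Z [|b B] //=; rewrite -IH.
Qed.


Lemma set_minP X : X != set0 -> exists2 x, x \in X & forall y, y \in X -> (x <= y)%N.
Proof.
case/set0Pn=> x0 x0X; case: (arg_minnP (fun x : 'I_N => x : nat) x0X) => x xX xP.
by exists x.
Qed.

Lemma alternating_exists X Y : X != set0 ->
  (forall y, y \in Y -> exists2 x, x \in X & (x <= y)%N) ->
  exists A B, [/\ decomposition X A, decomposition Y B & alternating A B].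
Proof.
have [c] := ubnP (#|X| + #|Y|)%N; elim: c X Y => // c IH X Y ltc X0 YX.
have dec1 Z : Z != set0 -> decomposition Z [:: Z].
  by move=> Z0; rewrite /decomposition big_seq1 eqxx /= inE eq_sym Z0.
have [Y0|Y0] := eqVneq Y set0.
  exists [:: X], [::]; split=> //; first exact: dec1.
  by rewrite /decomposition big_nil Y0 eqxx.
pose X1 := [set x in X | [forall y in Y, (x <= y)%N]].
have [y0 y0Y y0P] := set_minP Y0.
have [x0 x0X x0P] := YX _ y0Y.
have x0X1 : x0 \in X1.
  rewrite inE x0X; apply/forall_inP=> y /y0P; exact: leq_trans.
have X10 : X1 != set0 by apply/set0Pn; exists x0.
have sX1 : X1 \subset X by apply/subsetP=> x; rewrite inE => /andP[].
have X'P x : x \in X :\: X1 -> exists2 y, y \in Y & (y < x)%N.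
  rewrite !inE => /andP[+ xX]; rewrite xX /=.
  by case/forall_inPn=> y yY; rewrite -ltnNge; exists y.
case: (IH Y (X :\: X1)) => // [|x /X'P[y yY ltyx]|B [A [dB dA altBA]]].
- rewrite addnC -ltnS; apply: (leq_trans _ ltc); rewrite ltnS ltn_add2r.
  rewrite cardsD (setIidPr sX1) ltn_subrL !card_gt0 X10 /=.
  by apply/set0Pn; exists x0.
- by exists y => //; apply: ltnW.
exists (X1 :: A), B; split=> //.
- case/and3P: dA => /eqP dA A0 sA; apply/and3P; split.
  + by rewrite big_cons dA setUC setDE setUIl [~: _ :|: _]setUC setUCr setIT (setUidPl sX1).
  + by rewrite inE eq_sym (negPf X10).
  rewrite /= sA andbT; apply/allP=> Z ZA; apply/forall_inP=> x xX1.
  apply/forall_inP=> x' x'Z.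
  have /X'P[y yY ltyx'] : x' \in X :\: X1.
    by rewrite -dA (big_rem Z ZA) inE x'Z.
  apply: (leq_ltn_trans _ ltyx'); move: xX1; rewrite inE => /andP[_].
  by move/forall_inP/(_ y yY).
- case/andP: altBA => /andP[sAB sBA] srt; apply/andP; split; first by rewrite /= sBA ltnS sAB.
  rewrite interleave_cons; case: B dB {sAB sBA} srt => [|b B] dB srt.
    by move: dB Y0; rewrite /decomposition big_nil eq_sym => /and3P[/eqP->]; rewrite eqxx.
  rewrite interleave_cons in srt *.
  rewrite /= in srt *; rewrite srt andbT; apply/forall_inP=> x.
  rewrite inE => /andP[_ /forall_inP xP]; apply/forall_inP=> y yb; apply: xP.
  by case/and3P: dB => /eqP <- _ _; rewrite big_cons inE yb.
Qed.

Lemma shuffling_exists X Y : X != set0 -> Y != set0 ->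
  exists n, has_shuffling X Y n.
Proof.
move=> X0 Y0.
have size_gt0 Z C : Z != set0 -> decomposition Z C -> (0 < size C)%N.
  by move=> Z0 /and3P[]; case: C => //; rewrite big_nil eq_sym (negPf Z0).
have [x xX xP] := set_minP X0; have [y yY yP] := set_minP Y0.
suff [A [B AB]] : exists A B, is_shuffling X Y A B.
  exists (size A + size B).-1; apply/has_shufflingP; exists A, B; split=> //.
  by case/and3P: AB => /(size_gt0 _ _ X0); case: (size A).
case: (leqP x y) => xy.
- have [|A [B [dA dB AB]]] := alternating_exists X0 (Y := Y).
    by move=> z /yP yz; exists x => //; apply: leq_trans xy yz.
  by exists A, B; rewrite /is_shuffling dA dB AB.
- have [|B [A [dB dA BA]]] := alternating_exists Y0 (Y := X).
    by move=> z /xP xz; exists y => //; apply: leq_trans (ltnW xy) xz.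
  by exists A, B; rewrite /is_shuffling dA dB BA orbT.
Qed.

End LinkingNumber.

Lemma im_neq0 p m (f : delta p m) : im f != set0.
Proof. by apply/set0Pn; exists (f ord0); apply: imset_f. Qed.

Definition lk p q m (tau : delta p m) (pi : delta q m) : nat :=
  ex_minn (shuffling_exists (im_neq0 tau) (im_neq0 pi)).

Definition n_commutative (k : comPzRingType) (n : nat)
    (E : cosimplicial_monoid k) : Prop :=
  forall (p q m : nat) (tau : delta p m) (pi : delta q m),
    (lk tau pi <= n)%N -> forall (a : E p) (b : E q),
      GRing.comm (cosimp_map E tau a) (cosimp_map E pi b).

Definition dir1 : bool := false.
Definition dir2 : bool := true.

Section LatticePath.

Variables p q m : nat.

Let N := (p.+1 + q.+1)%N.

(* A lattice path <m+1> -> <p+1> [] <q+1>: its word, and the labels of the N+1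
   points of the path, listed from (0,0) to (p+1,q+1).  These points are
   distinct and labels vanish off the path, so this is all the labelling; the
   labels have sum m+2 and so lie in 'I_m.+3. *)
Definition is_lpath (d : N.-tuple bool * {ffun 'I_N.+1 -> 'I_m.+3}) : bool :=
  [&& count_mem dir1 d.1 == p.+1, count_mem dir2 d.1 == q.+1,
      (0 < d.2 ord0)%N, (0 < d.2 ord_max)%N
    & (\sum_(t < N.+1) d.2 t)%N == m.+2].

Record lpath := Lpath { lpath_val : N.-tuple bool * {ffun 'I_N.+1 -> 'I_m.+3};
                        _ : is_lpath lpath_val }.

HB.instance Definition _ := [isSub for lpath_val].
HB.instance Definition _ := [Finite of lpath by <:].

Implicit Type psi : lpath.

Definition word psi : N.-tuple bool := (lpath_val psi).1.
Definition label psi : {ffun 'I_N.+1 -> 'I_m.+3} := (lpath_val psi).2.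

(* The point reached after t unit steps. *)
Definition point psi (t : nat) : nat * nat :=
  (count_mem dir1 (take t (word psi)), count_mem dir2 (take t (word psi))).

Definition visits psi : seq nat :=
  flatten [seq nseq (label psi t) (t : nat) | t <- enum 'I_N.+1].

(* psi(0), ..., psi(m+1) *)
Definition psi_at psi (i : nat) : nat * nat :=
  nth (0, 0)%N [seq point psi t | t <- visits psi] i.

Definition xc psi (i : nat) : nat := (psi_at psi i).1.
Definition yc psi (i : nat) : nat := (psi_at psi i).2.

Definition corner psi (t : nat) : bool :=
  [&& (0 < t)%N, (t < N)%N & nth dir1 (word psi) t.-1 != nth dir1 (word psi) t].

Definition complexity psi : nat := #|[set t : 'I_N.+1 | corner psi t]|.

Definition even_lpath psi : bool := nth dir1 (word psi) 0 == dir1.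

Definition inversions psi : nat :=
  #|[set st : 'I_N * 'I_N | [&& (st.1 < st.2)%N,
       tnth (word psi) st.1 == dir2 & tnth (word psi) st.2 == dir1]]|.

Definition sgn psi : int := (-1) ^+ inversions psi.

Definition normal psi : bool :=
  [forall t : 'I_N.+1, (label psi t : nat) == if corner psi t then 0%N else 1%N].

(* Coordinates never decrease along a path, so the truncated subtractions are
   exact. *)
Definition step psi (i : nat) : nat * nat :=
  (xc psi i.+1 - xc psi i, yc psi i.+1 - yc psi i)%N.

Definition smooth psi : bool :=
  [forall i : 'I_m.+1, step psi i \in [:: (1, 0); (0, 1); (1, 1)]%N] &&
  [forall i : 'I_m, (step psi i, step psi i.+1) \notin
     [:: ((1, 0), (0, 1)); ((0, 1), (1, 0))]%N].

Lemma size_visits psi : size (visits psi) = m.+2.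
Proof.
case: psi => d dP; rewrite /visits /label /= size_flatten /shape -map_comp.
case/and5P: dP => _ _ _ _ /eqP dm; apply: etrans dm; rewrite sumnE big_map big_enum.
by apply: eq_bigr => t _ /=; rewrite size_nseq.
Qed.

Lemma sorted_visits psi : sorted leq (visits psi).
Proof.
rewrite /visits; have : sorted leq [seq val t | t <- enum 'I_N.+1].
  by rewrite val_enum_ord iota_sorted.
rewrite !sorted_pairwise; try exact: leq_trans.
elim: (enum _) => //= t s IH /andP[ts /IH sP]; rewrite pairwise_cat sP andbT.
apply/andP; split.
  apply/allrelP=> x y /nseqP[-> _] /flatten_mapP[u us]; case/nseqP=> -> _.
  by move/allP: ts; apply; apply: map_f.
by elim: (nat_of_ord (label psi t)) => //= c ->; rewrite andbT; apply/allP => x /nseqP[-> _].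
Qed.

Lemma visits_nth0 psi : nth 0%N (visits psi) 0 = 0%N.
Proof.
rewrite /visits enum_ordSl /=; have /and5P[_ _ l0 _ _] := valP psi.
by rewrite /label; case: (nat_of_ord _) l0.
Qed.

Lemma visits_last psi : nth 0%N (visits psi) m.+1 = N.
Proof.
have -> : m.+1 = (size (visits psi)).-1 by rewrite size_visits.
rewrite nth_last /visits enum_ordSr map_rcons -cats1 flatten_cat last_cat /= cats0.
have /and5P[_ _ _ lN _] := valP psi.
by rewrite /label; case: (nat_of_ord _) lN => //= c _; elim: c.
Qed.

Lemma psi_atE psi i : (i < m.+2)%N -> psi_at psi i = point psi (nth 0%N (visits psi) i).
Proof. by move=> im; rewrite /psi_at (nth_map 0%N) ?size_visits. Qed.

Lemma point_mono psi t u : (t <= u)%N ->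
  ((point psi t).1 <= (point psi u).1)%N /\ ((point psi t).2 <= (point psi u).2)%N.
Proof.
move=> tu; have tE : take t (word psi) = take t (take u (word psi)).
  by rewrite take_takel.
by rewrite /point /= tE; split;
   rewrite -[X in (_ <= count_mem _ X)%N](cat_take_drop t) count_cat leq_addr.
Qed.

Lemma coord_mono psi i j : (i <= j)%N -> (j < m.+2)%N ->
  (xc psi i <= xc psi j)%N /\ (yc psi i <= yc psi j)%N.
Proof.
move=> ij jm; rewrite /xc /yc !psi_atE ?(leq_ltn_trans ij) //.
apply: point_mono; apply: (sorted_leq_nth leq_trans leqnn _ (sorted_visits psi)) => //;
  by rewrite inE size_visits // (leq_ltn_trans ij).
Qed.

Lemma xc0 psi : xc psi 0 = 0%N.
Proof. by rewrite /xc psi_atE // visits_nth0 /point take0. Qed.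

Lemma yc0 psi : yc psi 0 = 0%N.
Proof. by rewrite /yc psi_atE // visits_nth0 /point take0. Qed.

Lemma xc_last psi : xc psi m.+1 = p.+1.
Proof.
rewrite /xc psi_atE // visits_last /point take_oversize ?size_tuple //.
by have /and5P[/eqP] := valP psi.
Qed.

Lemma yc_last psi : yc psi m.+1 = q.+1.
Proof.
rewrite /yc psi_atE // visits_last /point take_oversize ?size_tuple //.
by have /and5P[_ /eqP] := valP psi.
Qed.

End LatticePath.

Definition joyal_fun (r m : nat) (x : nat -> nat) (j : 'I_r.+1) : 'I_m.+1 :=
  odflt ord0 [pick i : 'I_m.+1 | x i <= j < x i.+1]%N.

Lemma joyal_funP r m (x : nat -> nat) (j : 'I_r.+1) : x 0%N = 0%N -> x m.+1 = r.+1 ->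
  (x (joyal_fun m x j) <= j < x (joyal_fun m x j).+1)%N.
Proof.
move=> x0 xm; rewrite /joyal_fun; case: pickP => [i //|none]; exfalso.
suff H i : (i <= m.+1)%N -> (x i <= j)%N.
  by have := H _ (leqnn _); rewrite xm leqNgt ltn_ord.
elim: i => [|i IH] im; first by rewrite x0.
by have := none (Ordinal im); rewrite /= (IH (ltnW im)) /= => /negbT; rewrite -leqNgt.
Qed.

Lemma joyal_mono r m (x : nat -> nat) : x 0%N = 0%N -> x m.+1 = r.+1 ->
  (forall i j, (i <= j)%N -> (j < m.+2)%N -> (x i <= x j)%N) ->
  forall j1 j2 : 'I_r.+1, (j1 <= j2)%N -> (joyal_fun m x j1 <= joyal_fun m x j2)%N.
Proof.
move=> x0 xm xP j1 j2 j12.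
have /andP[x1 _] := joyal_funP j1 x0 xm; have /andP[_ x2] := joyal_funP j2 x0 xm.
rewrite leqNgt; apply/negP => lt21.
have := xP _ _ lt21 (ltnW (ltn_ord (joyal_fun m x j1))).
by move/(leq_trans x2)/leq_trans/(_ x1); rewrite ltnNge j12.
Qed.

Definition joyal1 p q m (psi : lpath p q m) : delta p m :=
  mk_delta (joyal_mono (xc0 psi) (xc_last psi)
              (fun i j ij jm => (coord_mono psi ij jm).1)).

Definition joyal2 p q m (psi : lpath p q m) : delta q m :=
  mk_delta (joyal_mono (yc0 psi) (yc_last psi)
              (fun i j ij jm => (coord_mono psi ij jm).2)).

Definition nlp_pos (n p q m : nat) : {set lpath p q m} :=
  [set psi | [&& normal psi, complexity psi == n & even_lpath psi]].

Definition slp_pos (n p q m : nat) : {set lpath p q m} :=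
  [set psi | [&& smooth psi, complexity psi == n & even_lpath psi]].

Definition slp_neg (n p q m : nat) : {set lpath p q m} :=
  [set psi | [&& smooth psi, complexity psi == n & ~~ even_lpath psi]].

(* (-1)^((p-1)(q-1)), the exponent being an integer: p or q may be 0.
   Exchanging the letters 1 and 2 of a word turns sgn into
   (-1)^((p+1)(q+1)) sgn = shift_sign p q * sgn, and exchanges even paths acting
   on b (x) a with odd paths acting on a (x) b. *)
Definition shift_sign (p q : nat) : int := (-1) ^ ((p%:Z - 1) * (q%:Z - 1)).

Section Operations.

Variables (k : comPzRingType) (E : cosimplicial_monoid k) (p q : nat).

Definition act m (psi : lpath p q m) (a : E p) (b : E q) : E m :=
  if even_lpath psi
  then cosimp_map E (joyal1 psi) a * cosimp_map E (joyal2 psi) b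
  else cosimp_map E (joyal2 psi) b * cosimp_map E (joyal1 psi) a.

(* The degree m of the target is a parameter; the sum is empty unless
   m = p + q - i. *)
Definition cup (i m : nat) (a : E p) (b : E q) : E m :=
  \sum_(psi in nlp_pos i.+1 p q m) act psi a b *~ (shift_sign p q * sgn psi).

End Operations.

Definition bracket (k : comPzRingType) (E : cosimplicial_monoid k) (n p q m : nat)
    (a : E p) (b : E q) : E m :=
  cup n.-1 m a b - cup n.-1 m b a *~ ((-1) ^+ n * shift_sign p q).

(* Main.v *)
Require Import Defs.
From mathcomp Require Import all_boot all_order all_algebra.
From mathcomp Require Import ring.
Set Implicit Arguments.
Unset Strict Implicit.
Unset Printing Implicit Defensive.
Import GRing.Theory.
Local Open Scope ring_scope.

(** The sum over smooth paths is part of the sum over normal paths, and the rest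
    of the latter vanishes on normalised cochains.

    In a path of complexity i+1 with m = p + q - i, the number of points that
    are not corners is m+2, the sum of the labels.  A smooth path visits each
    point at most once and leaves out only corners, hence leaves out all of them
    and is normal ([smooth_normal]).  Conversely a normal path leaves out
    exactly its corners, and it fails to be smooth only when two corners are
    adjacent on it; the step that jumps over them moves one coordinate by at
    least 2 ([normal_smooth]).  The Joyal dual of that coordinate then takes
    the same value at two consecutive arguments, so it factors through a
    codegeneracy, which kills normalised cochains.  So the path acts by zero
    ([act_normal_not_smooth]), and the formula for the products follows
    ([cup_smooth]).

    For the bracket, reflecting paths in the diagonal turns even smooth paths
    acting on b (x) a into odd smooth paths acting on a (x) b.  The inversions
    of a word and of its reflection together number (p+1)(q+1), so the sign
    changes by [shift_sign p q] ([sgn_swap]); this cancels against the sign in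
    front of the reflected product. *)

(** * Normalised cochains vanish on non-injective maps *)

(** A map taking the same value at j and j+1 factors through the codegeneracy
    that hits j twice: the other factor is f composed with the coface that
    skips j+1. *)
Lemma normalised_map0 (k : comPzRingType) (E : cosimplicial_monoid k) p m
    (f : delta p m) (a : E p) (j j' : 'I_p.+1) :
  normalised a -> j' = j.+1 :> nat -> f j = f j' -> cosimp_map E f a = 0.
Proof.
case: p => [|p] in f a j j' *; first by rewrite !ord1.
move=> aP j'j fj.
have ltj : (j < p.+1)%N by rewrite -ltnS -j'j ltn_ord.
have gP (u v : 'I_p.+1) : (u <= v)%N -> (f (lift j' u) <= f (lift j' v))%N.
  by move=> uv; apply: deltaP; rewrite /= leq_bump2.
have -> : f = delta_comp (mk_delta gP) (codegen (Ordinal ltj)).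
  apply: val_inj; apply/ffunP=> u; rewrite !ffunE.
  have [ju|ju] := eqVneq (u : nat) j.+1.
    have -> : u = j' by apply: val_inj; rewrite /= ju.
    rewrite -fj; congr (f _); apply: val_inj.
    by rewrite /= /bump j'j ltnn /= ltnn.
  congr (f _); apply: val_inj; rewrite /= /bump j'j.
  case: (leqP u j) => uj; first by rewrite ltnNge uj.
  have u_gt : (j.+1 < u)%N by rewrite ltn_neqAle eq_sym ju.
  by case: (nat_of_ord u) u_gt => // v /=; rewrite ltnS => ->.
by rewrite cosimp_map_comp /= aP raddf0.
Qed.

Lemma joyal_fun_eq r m (x : nat -> nat) (j : 'I_r.+1) (i : 'I_m.+1) :
  x 0%N = 0%N -> x m.+1 = r.+1 ->
  (forall u v, (u <= v)%N -> (v < m.+2)%N -> (x u <= x v)%N) ->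
  (x i <= j < x i.+1)%N -> joyal_fun m x j = i.
Proof.
move=> x0 xm xP /andP[ij ji].
have /andP[] := joyal_funP j x0 xm; move: (joyal_fun m x j) => u uj ju.
apply: val_inj; apply/eqP; rewrite /= eqn_leq; apply/andP; split.
  rewrite leqNgt; apply/negP=> /xP/(_ (ltnW (ltn_ord u))).
  by rewrite leqNgt (leq_ltn_trans uj ji).
rewrite leqNgt; apply/negP=> /xP/(_ (ltnW (ltn_ord i))).
by rewrite leqNgt (leq_ltn_trans ij ju).
Qed.

(** When x jumps by at least 2 between i and i+1, the Joyal dual sends both
    x i and x i + 1 to i, so it is not injective. *)
Lemma joyal_gap_map0 (k : comPzRingType) (E : cosimplicial_monoid k) r m
    (f : delta r m) (x : nat -> nat) (a : E r) (i : 'I_m.+1) :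
  x 0%N = 0%N -> x m.+1 = r.+1 ->
  (forall u v, (u <= v)%N -> (v < m.+2)%N -> (x u <= x v)%N) ->
  f =1 joyal_fun m x -> normalised a ->
  (1 < x i.+1 - x i)%N -> cosimp_map E f a = 0.
Proof.
move=> x0 xm xP fE aP; rewrite ltn_subRL addn1 => gap.
have le_xr : (x i.+1 <= r.+1)%N by rewrite -xm; apply: xP.
have lt2 : ((x i).+1 < r.+1)%N := leq_trans gap le_xr.
apply: (normalised_map0 (j := Ordinal (ltnW lt2)) (j' := Ordinal lt2)) => //.
rewrite !fE !(joyal_fun_eq (i := i)) //=.
  by rewrite leqnSn.
by rewrite leqnn ltnW.
Qed.

(** * Normal and smooth lattice paths *)

(** Below, [v i] is the position along the path, counted in unit steps from
    the origin, of its i-th point with multiplicity. *)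
Section Paths.

Variables (p q m : nat) (psi : lpath p q m).
Let N := (p.+1 + q.+1)%N.
Let v := nth 0%N (visits psi).

Lemma pointS t : (t < N)%N ->
  point psi t.+1 = ((point psi t).1 + (nth dir1 (word psi) t == dir1),
                    (point psi t).2 + (nth dir1 (word psi) t == dir2))%N.
Proof.
move=> tN; rewrite /point (take_nth dir1) ?size_tuple //.
by rewrite -cats1 !count_cat /= !addn0.
Qed.

Lemma point_sum t : (t <= N)%N -> ((point psi t).1 + (point psi t).2 = t)%N.
Proof.
elim: t => [|t IH] tN; first by rewrite /point take0.
by rewrite pointS //= addnACA IH ?(ltnW tN) //; case: nth; rewrite addn1.
Qed.

Lemma cornerE t : (t.+1 < N)%N ->
  corner psi t.+1 = ((point psi t.+2).1 == (point psi t).1.+1).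
Proof.
move=> tN; rewrite /corner tN !pointS ?(ltnW tN) //= -addnA.
rewrite -[(count_mem _ _).+1]addn1 eqn_add2l.
by case: nth; case: nth.
Qed.

Lemma visits_le i j : (i <= j)%N -> (j < m.+2)%N -> (v i <= v j)%N.
Proof.
move=> ij jm; apply: (sorted_leq_nth leq_trans leqnn _ (sorted_visits psi)) => //;
  by rewrite inE size_visits // (leq_ltn_trans ij).
Qed.

Lemma visits_leN i : (i < m.+2)%N -> (v i <= N)%N.
Proof. by rewrite ltnS => im; rewrite /N -(visits_last psi) visits_le. Qed.

Lemma step_xc i : (i < m.+1)%N -> xc psi i.+1 = (xc psi i + (step psi i).1)%N.
Proof. by move=> im; rewrite subnKC //; case: (coord_mono psi (leqnSn i) _). Qed.

Lemma step_yc i : (i < m.+1)%N -> yc psi i.+1 = (yc psi i + (step psi i).2)%N.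
Proof. by move=> im; rewrite subnKC //; case: (coord_mono psi (leqnSn i) _). Qed.

Lemma coord_sum i : (i < m.+2)%N -> (xc psi i + yc psi i = v i)%N.
Proof. by move=> im; rewrite /xc /yc psi_atE // point_sum // visits_leN. Qed.

Lemma step_sum i : (i < m.+1)%N ->
  v i.+1 = (v i + ((step psi i).1 + (step psi i).2))%N.
Proof.
move=> im; rewrite -(@coord_sum i.+1 im) -(@coord_sum i (leqW im)).
by rewrite step_xc // step_yc // addnACA.
Qed.

(** Skipping a single point of the path is a diagonal step exactly when the
    skipped point is a corner; otherwise it is (2,0) or (0,2). *)
Lemma corner_between i t : (i < m.+1)%N -> v i = t -> v i.+1 = t.+2 ->
  corner psi t.+1 = ((step psi i).1 == 1%N).
Proof.
move=> im vt vt2; have t2N : (t.+1 < N)%N by rewrite -vt2 visits_leN.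
rewrite cornerE // -vt2 -vt -!psi_atE ?(leqW im) //.
by rewrite -/(xc psi i.+1) -/(xc psi i) step_xc // -addn1 eqn_add2l.
Qed.

Lemma mult_visits (t : 'I_N.+1) : count_mem (t : nat) (visits psi) = label psi t.
Proof.
rewrite /visits count_flatten -map_comp sumnE big_map big_enum /= (bigD1 t) //=.
rewrite count_nseq /= eqxx mul1n big1 ?addn0 // => u ut.
by rewrite count_nseq /= (inj_eq val_inj) (negPf ut).
Qed.

Lemma visits_ltN t : t \in visits psi -> (t < N.+1)%N.
Proof. by case/(nthP 0%N)=> i; rewrite size_visits => im <-; apply: visits_leN. Qed.

Lemma normal_visits_sorted : normal psi -> sorted ltn (visits psi).
Proof.
move=> /forallP nP; rewrite ltn_sorted_uniq_leq sorted_visits andbT.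
apply: count_mem_uniq => t.
have [tv|] := boolP (t \in visits psi); last by move/count_memPn.
have tN := visits_ltN tv; move: tv.
rewrite -[t]/(nat_of_ord (Ordinal tN)) -has_pred1 has_count mult_visits.
by rewrite (eqP (nP _)); case: ifP.
Qed.

(** In a normal path a step (1,0) never meets a step (0,1), because they would
    meet at a corner, whose label is 0.  So smoothness can only fail by a
    step that is too long, one that jumps over a run of consecutive corners. *)
Lemma normal_smooth : normal psi ->
  (forall i : 'I_m.+1, (step psi i).1 <= 1 /\ (step psi i).2 <= 1)%N ->
  smooth psi.
Proof.
move=> nP small; have srt := normal_visits_sorted nP.
have v_lt i : (i < m.+1)%N -> (v i < v i.+1)%N.
  move=> im; apply: (sorted_ltn_nth ltn_trans) => //;
    by rewrite inE size_visits // ltnS ltnW.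
apply/andP; split; apply/forallP=> i.
  have [] := small i; have := v_lt i (ltn_ord i).
  rewrite step_sum // -[X in (X < _)%N]addn0 ltn_add2l !inE.
  by case: (step psi i) => -[|[|x]] [|[|y]].
have im : (i < m.+1)%N by rewrite ltnS ltnW.
have im1 : (i.+1 < m.+1)%N by rewrite ltnS.
pose t := v i.
(* The meeting point, at position t+1, is both a corner and visited. *)
apply/negP=> bad.
have [vS vSS x2] : [/\ v i.+1 = t.+1, v i.+2 = t.+2
                   & xc psi i.+2 = (xc psi i).+1].
  rewrite (step_sum im1) (step_sum im) (step_xc im1) (step_xc im) -/t.
  case: (step psi i) bad => s1 s2; case: (step psi i.+1) => s3 s4.
  rewrite !inE !xpair_eqE.
  by case/orP=> /andP[/andP[/eqP-> /eqP->] /andP[/eqP-> /eqP->]];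
    rewrite /= ?addn0 ?addn1.
have tN : (t.+1 < N)%N by rewrite -vSS visits_leN.
have : t.+1 \in visits psi by rewrite -vS mem_nth // size_visits ltnW.
have tN' : (t.+1 < N.+1)%N by apply: ltnW.
rewrite -[t.+1]/(nat_of_ord (Ordinal tN')) -has_pred1 has_count mult_visits.
have /forallP/(_ (Ordinal tN'))/eqP-> := nP.
rewrite /= cornerE // -vSS -[t]/(v i) -!psi_atE ?(leqW im) //.
by rewrite -/(xc psi i.+2) -/(xc psi i) x2 eqxx.
Qed.

Lemma smooth_visits_uniq : smooth psi -> uniq (visits psi).
Proof.
case/andP=> /forallP sP _; apply: (sorted_uniq ltn_trans ltnn).
apply/(sortedP 0%N) => i; rewrite size_visits ltnS => im.
rewrite -/v step_sum // -[X in (X < _)%N]addn0 ltn_add2l.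
have : step psi i \in [:: (1, 0); (0, 1); (1, 1)]%N := sP (Ordinal im).
by case: (step psi i) => -[|x] [|y].
Qed.

(** Since a smooth step has length at most 2, it skips at most one point, and
    then it is diagonal. *)
Lemma smooth_corner (t : 'I_N.+1) :
  smooth psi -> label psi t = 0%N :> nat -> corner psi t.
Proof.
case/andP=> /forallP sP _; rewrite -mult_visits => /count_memPn tv.
have tN : (t < N)%N.
  rewrite ltn_neqAle -ltnS ltn_ord andbT; apply: contra tv => /eqP->.
  by rewrite /N -(visits_last psi) mem_nth // size_visits.
(* [joyal_funP] finds the two consecutive visits around the position t. *)
have /andP[] := @joyal_funP (p + q.+1) m v (Ordinal tN)
  (visits_nth0 psi) (visits_last psi).
move: (joyal_fun _ _ _) => i /= vt tv1.
have vt_ne : v i != t.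
  by apply: contra tv => /eqP<-; rewrite mem_nth // size_visits leqW.
have {vt vt_ne} vt : (v i < t)%N by rewrite ltn_neqAle vt_ne.
have stepE : step psi i = (1, 1)%N.
  have := leq_ltn_trans vt tv1; rewrite step_sum // -addn1 ltn_add2l.
  by move: (sP i); rewrite !inE; case: (step psi i) => -[|[|x]] [|[|y]].
have vE : v i.+1 = (v i).+2 by rewrite step_sum // stepE addn2.
have tE : t = (v i).+1 :> nat by apply/eqP; rewrite eqn_leq vt andbT -ltnS -vE.
by rewrite tE (corner_between (i := i)) // stepE.
Qed.

(** All labels are at most 1 and sum to m+2, and the path has p+q+3 points, so
    p+q+1-m = i+1 points have label 0.  These are corners, and there are only
    i+1 corners, so they are all of them. *)
Lemma smooth_normal i : (m + i = p + q)%N ->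
  smooth psi -> complexity psi = i.+1 -> normal psi.
Proof.
move=> mi sP cP.
have l1 (t : 'I_N.+1) : (label psi t <= 1)%N.
  by rewrite -mult_visits count_uniq_mem ?smooth_visits_uniq ?leq_b1.
pose Z := [set t : 'I_N.+1 | label psi t == 0%N :> nat].
have cardZ : (m.+2 + #|Z| = N.+1)%N.
  rewrite -[RHS]card_ord -(cardC Z) addnC; congr (_ + _)%N.
  have /and5P[_ _ _ _ /eqP sum_label] := valP psi.
  apply: (etrans (esym sum_label)).
  rewrite -sum1_card [RHS]big_mkcond /=.
  apply: eq_bigr => t _.
  rewrite !inE -/(label psi); move: (l1 t).
  by case: (nat_of_ord (label psi t)) => [|[|]].
have ZC : Z = [set t : 'I_N.+1 | corner psi t].
  apply/eqP; rewrite eqEcard; apply/andP; split.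
    by apply/subsetP=> t; rewrite !inE => /eqP; apply: smooth_corner.
  rewrite -/(complexity psi) cP -(leq_add2l m.+2) cardZ.
  by rewrite /N !addSn !addnS mi.
apply/forallP=> t; have := erefl (t \in Z); rewrite {2}ZC !inE => <-.
by move: (l1 t); case: (nat_of_ord (label psi t)) => [|[|]].
Qed.

Lemma act_normal_not_smooth (k : comPzRingType) (E : cosimplicial_monoid k)
    (a : E p) (b : E q) :
  normalised a -> normalised b -> normal psi -> ~~ smooth psi -> act psi a b = 0.
Proof.
move=> aP bP nP; apply: contraNeq => act0; apply: (normal_smooth nP) => i.
have xmono u w (uw : (u <= w)%N) (wm : (w < m.+2)%N) := (coord_mono psi uw wm).1.
have ymono u w (uw : (u <= w)%N) (wm : (w < m.+2)%N) := (coord_mono psi uw wm).2.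
split; rewrite leqNgt; apply: contraNN act0 => gap.
  have a0 : cosimp_map E (joyal1 psi) a = 0.
    apply: (joyal_gap_map0 (xc0 psi) (xc_last psi) xmono _ aP gap) => j.
    by rewrite /= ffunE.
  by rewrite /act a0 mul0r mulr0 if_same.
have b0 : cosimp_map E (joyal2 psi) b = 0.
  apply: (joyal_gap_map0 (yc0 psi) (yc_last psi) ymono _ bP gap) => j.
  by rewrite /= ffunE.
by rewrite /act b0 mul0r mulr0 if_same.
Qed.

End Paths.

Lemma cup_smooth (k : comPzRingType) (E : cosimplicial_monoid k) p q m i
    (a : E p) (b : E q) :
  (m + i = p + q)%N -> normalised a -> normalised b ->
  cup i m a b =
    \sum_(psi in slp_pos i.+1 p q m) act psi a b *~ (shift_sign p q * sgn psi).
Proof.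
move=> mi aP bP; rewrite /cup (bigID (@smooth p q m)) /= addrC big1 ?add0r.
  apply: eq_bigl => psi; rewrite !inE; apply/andP/idP => [[/and3P[_ -> ->] ->] //|].
  case/and3P=> sP cP ->; rewrite sP cP.
  by rewrite (smooth_normal mi sP (eqP cP)).
move=> psi /andP[]; rewrite inE => /and3P[nP _ _] sP.
by rewrite act_normal_not_smooth // mul0rz.
Qed.

(** * Exchanging the two directions *)

Lemma shift_signE p q : shift_sign p q = (-1) ^+ (p.+1 * q.+1).
Proof.
rewrite /shift_sign.
have -> : (p%:Z - 1) * (q%:Z - 1) = (p.+1 * q.+1)%N%:Z - (2 * (p + q))%N%:Z.
  by rewrite -!(addn1 p) -!(addn1 q) !PoszM !PoszD; ring.
by rewrite exprzDr ?unitrN1 // -exprnN -exprVn invrN1 exprM sqrrN expr1n mulr1.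
Qed.

Lemma shift_sign_sqr p q : shift_sign p q * shift_sign p q = 1.
Proof. by rewrite shift_signE -expr2 sqrr_sign. Qed.

Lemma shift_signC p q : shift_sign p q = shift_sign q p.
Proof. by rewrite /shift_sign mulrC. Qed.

Lemma count_negb b (s : seq bool) : count_mem b (map negb s) = count_mem (~~ b) s.
Proof. by rewrite count_map; apply: eq_count => c /=; case: b c => -[]. Qed.

(** Reflecting a path in the diagonal exchanges the letters of its word; the
    labels stay in order along the path.  The two types of paths have lengths
    p+1 + q+1 and q+1 + p+1, whence the transport along [addnC] of the word
    and the renumbering by [inord] of the labels. *)
Section Swap.

Variables (p q m : nat) (psi : lpath p q m).
Let N := (p.+1 + q.+1)%N.
Let N' := (q.+1 + p.+1)%N.

Definition swap_val : N'.-tuple bool * {ffun 'I_N'.+1 -> 'I_m.+3} :=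
  (tcast (addnC p.+1 q.+1) (map_tuple negb (word psi)),
   [ffun t : 'I_N'.+1 => label psi (inord t)]).

Lemma swap_subproof : is_lpath swap_val.
Proof.
have /and5P[/eqP c1 /eqP c2 l0 lN /eqP sum_label] := valP psi.
have NE : N' = N by rewrite /N' addnC.
have i0 : inord 0 = ord0 :> 'I_N.+1 by apply: val_inj; rewrite /= inordK.
have iN : inord N' = ord_max :> 'I_N.+1.
  by apply: val_inj; rewrite /= inordK NE.
rewrite /is_lpath /= val_tcast !count_negb c1 c2 !eqxx !ffunE /= i0 iN.
rewrite /label l0 lN /=.
under eq_bigr do rewrite ffunE.
rewrite -(big_mkord xpredT (fun t => (lpath_val psi).2 (inord t) : nat)).
rewrite -/N' NE big_mkord; apply/eqP/(etrans _ sum_label)/eq_bigr => t _.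
by rewrite inord_val.
Qed.

Definition swap : lpath q p m := Lpath swap_subproof.

Lemma word_swap : word swap = map negb (word psi) :> seq bool.
Proof. by rewrite /word /= val_tcast. Qed.

Lemma nth_word_swap t : (t < N)%N ->
  nth dir1 (word swap) t = ~~ nth dir1 (word psi) t.
Proof. by move=> tN; rewrite word_swap (nth_map dir1) ?size_tuple. Qed.

Lemma label_swap (t : nat) : (t < N.+1)%N ->
  label swap (inord t) = label psi (inord t).
Proof.
move=> tN; rewrite /label /= ffunE inordK //.
by rewrite /N' addnC.
Qed.

End Swap.

Lemma swapK p q m : cancel (@swap p q m) (@swap q p m).
Proof.
move=> psi; apply: val_inj; rewrite /= [RHS]surjective_pairing.
congr pair.
  apply: val_inj; rewrite /= val_tcast /= word_swap -map_comp.
  by rewrite -[RHS]map_id; apply: eq_map => b; apply: negbK.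
apply/ffunP=> t; rewrite ffunE label_swap ?inord_val //.
Qed.

(** The positions on a path and on its reflection range over ordinals of
    different types.  Indexing by natural numbers, here and in the next three
    lemmas, lets the two be compared. *)
Lemma visits_iota p q m (psi : lpath p q m) :
  visits psi =
    flatten [seq nseq (label psi (inord t)) t | t <- iota 0 (p.+1 + q.+1).+1].
Proof.
rewrite -val_enum_ord -map_comp /visits; congr flatten.
by apply: eq_map => t /=; rewrite inord_val.
Qed.

Lemma complexity_iota p q m (psi : lpath p q m) :
  complexity psi = (\sum_(0 <= t < (p.+1 + q.+1).+1) corner psi t)%N.
Proof.
rewrite big_mkord /complexity -sum1_card big_mkcond /=.
by apply: eq_bigr => t _; rewrite inE; case: corner.
Qed.

Lemma inversions_iota p q m (psi : lpath p q m) :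
  inversions psi =
    (\sum_(0 <= s < p.+1 + q.+1) \sum_(0 <= t < p.+1 + q.+1)
      [&& s < t, nth dir1 (word psi) s == dir2
        & nth dir1 (word psi) t == dir1])%N.
Proof.
rewrite /inversions -sum1_card big_mkcond /= big_mkord.
under [RHS]eq_bigr do rewrite big_mkord.
rewrite pair_bigA /=; apply: eq_bigr => -[s t] _ /=; rewrite inE /=.
by rewrite !(tnth_nth dir1); case: ifP.
Qed.

Lemma count_word_iota p q m (psi : lpath p q m) b :
  count_mem b (word psi) =
    (\sum_(0 <= t < p.+1 + q.+1) (nth dir1 (word psi) t == b))%N.
Proof.
rewrite -sum1_count big_mkcond (big_nth dir1) size_tuple.
by apply: eq_bigr => t _ /=; case: eqP.
Qed.

Section SwapTheory.

Variables (p q m : nat) (psi : lpath p q m).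

Lemma visits_swap : visits (swap psi) = visits psi.
Proof.
rewrite !visits_iota [in iota _ (q.+1 + _).+1]addnC; congr flatten.
apply/eq_in_map => t.
by rewrite mem_iota => tN; rewrite label_swap.
Qed.

Lemma point_swap t : point (swap psi) t = ((point psi t).2, (point psi t).1).
Proof. by rewrite /point word_swap -map_take !count_negb. Qed.

Lemma psi_at_swap i : psi_at (swap psi) i = ((psi_at psi i).2, (psi_at psi i).1).
Proof.
rewrite /psi_at visits_swap; have [iv|iv] := ltnP i (size (visits psi)).
  by rewrite !(nth_map 0%N) // point_swap.
by rewrite !nth_default ?size_map.
Qed.

Lemma xc_swap i : xc (swap psi) i = yc psi i.
Proof. by rewrite /xc psi_at_swap. Qed.

Lemma yc_swap i : yc (swap psi) i = xc psi i.
Proof. by rewrite /yc psi_at_swap. Qed.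

Lemma smooth_swap : smooth (swap psi) = smooth psi.
Proof.
have stepE i : step (swap psi) i = ((step psi i).2, (step psi i).1).
  by rewrite /step !xc_swap !yc_swap.
congr (_ && _); apply: eq_forallb => i; rewrite !stepE.
  by case: (step psi i) => -[|[|x]] [|[|y]].
by case: (step psi i) (step psi i.+1) => -[|[|x]] [|[|y]] [[|[|z]] [|[|w]]].
Qed.

Lemma complexity_swap : complexity (swap psi) = complexity psi.
Proof.
rewrite !complexity_iota [(q.+1 + p.+1)%N]addnC; apply: eq_bigr => t _.
congr nat_of_bool; rewrite /corner [X in (t < X)%N]addnC.
have [t0|//] := ltnP 0 t; have [tN|//] := ltnP t (p.+1 + q.+1) => /=.
rewrite !nth_word_swap // ?(inj_eq negb_inj) //.
by apply: leq_ltn_trans tN; apply: leq_pred.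
Qed.

Lemma even_swap : even_lpath (swap psi) = ~~ even_lpath psi.
Proof. by rewrite /even_lpath nth_word_swap //; case: nth. Qed.

Lemma joyal1_swap : joyal1 (swap psi) = joyal2 psi.
Proof.
apply: val_inj; apply/ffunP=> j; rewrite !ffunE /joyal_fun; congr odflt.
by apply: eq_pick => i; rewrite /= !xc_swap.
Qed.

Lemma joyal2_swap : joyal2 (swap psi) = joyal1 psi.
Proof.
apply: val_inj; apply/ffunP=> j; rewrite !ffunE /joyal_fun; congr odflt.
by apply: eq_pick => i; rewrite /= !yc_swap.
Qed.

Lemma act_swap (k : comPzRingType) (E : cosimplicial_monoid k)
  (a : E p) (b : E q) : act (swap psi) b a = act psi a b.
Proof. by rewrite /act even_swap joyal1_swap joyal2_swap; case: even_lpath. Qed.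

(** A pair formed by a letter 2 and a letter 1 is an inversion of exactly one of
    the two words. *)
Lemma inversions_swap : (inversions (swap psi) + inversions psi = p.+1 * q.+1)%N.
Proof.
have /and5P[/eqP c1 /eqP c2 _ _ _] := valP psi.
apply/(etrans _ (congr2 muln c1 c2)); rewrite -/(word psi).
rewrite !count_word_iota !inversions_iota.
rewrite [in index_iota _ (q.+1 + _)]addnC.
rewrite exchange_big mulnC big_distrl -big_split /=.
apply: eq_big_nat => s /andP[_ sN]; rewrite big_distrr -big_split /=.
apply: eq_big_nat => t /andP[_ tN]; rewrite !nth_word_swap // mulnb.
by case: (ltngtP s t) => [||->]; do 2?case: nth.
Qed.

Lemma sgn_swap : sgn (swap psi) = shift_sign p q * sgn psi.
Proof.
rewrite shift_signE -inversions_swap /sgn exprD -mulrA -expr2 sqrr_sign mulr1.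
by [].
Qed.

End SwapTheory.

Theorem theorem2p56 (k : comPzRingType) (n : nat) (E : cosimplicial_monoid k) :
  (1 <= n)%N ->
  n_commutative n.-1 E ->
  (forall (p q m i : nat) (a : E p) (b : E q),
      (i <= n.-1)%N -> (m + i = p + q)%N ->
      normalised a -> normalised b ->
      cup i m a b =
        \sum_(psi in slp_pos i.+1 p q m)
          act psi a b *~ (shift_sign p q * sgn psi))
  /\
  ((2 <= n)%N ->
   forall (p q m : nat) (a : E p) (b : E q),
      (m + n.-1 = p + q)%N ->
      normalised a -> normalised b ->
      bracket n m a b =
        cup n.-1 m a b
          - cup n.-1 m b a *~ (-1) ^ (n%:Z + (p%:Z - 1) * (q%:Z - 1))
      /\
      bracket n m a b =
        \sum_(psi in slp_pos n p q m)
          act psi a b *~ (shift_sign p q * sgn psi)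
        + \sum_(psi in slp_neg n p q m)
            act psi a b *~ (shift_sign p q * ((-1) ^+ n.-1 * sgn psi))).
Proof.
case: n => [//|n] _ _; split=> [p q m i a b _ mi aP bP|_ p q m a b mn aP bP].
  exact: cup_smooth.
split; first by rewrite /bracket /shift_sign exprzDr ?unitrN1.
rewrite /bracket /= cup_smooth //; congr (_ + _).
rewrite cup_smooth //; last by rewrite (addnC q).
rewrite (reindex_onto (@swap p q m) (@swap q p m)) /=;
  last by move=> psi _; apply: swapK.
rewrite -mulrNz mulrz_suml; apply: eq_big => [psi|psi _].
  by rewrite !inE swapK eqxx andbT smooth_swap complexity_swap even_swap.
rewrite act_swap sgn_swap -mulrzA; congr (_ *~ _).
rewrite (shift_signC q p).
rewrite exprS mulN1r mulNr opprK [LHS]mulrACA mulrA [X in X * _]mulrC.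
rewrite mulrACA [X in X * _]mulrA shift_sign_sqr mul1r; ring.
Qed.
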